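(* Let $d\ge2$ be fixed and let $S_d=\{\mathbf{x}\in\mathbb{R}^d: -1\le x_j\le 0 \text{ for all } j,\ \sum_{j=1}^d |x_j|\le 1\}$. Let $\mathbf{p}_1,\dots,\mathbf{p}_n$ be independent points uniformly distributed in $S_d$, and for $1\le k\le d$ let $M^{[s]}_{d,k}(n)$ be the number of $k$-dominant skyline points of $\{\mathbf{p}_1,\dots,\mathbf{p}_n\}$. Then, as $n\to\infty$, \[ \mathbb{E}[M^{[s]}_{d,k}(n)]\to\begin{cases}0,& \text{if } 1\le k\le d-1,\\ \infty, & \text{if } k=d.\end{cases} \]
   Context: For points $\mathbf{p}=(p_1,\dots,p_d)$, $\mathbf{q}=(q_1,\dots,q_d)$ of $\mathbb{R}^d$, $\mathbf{p}$ $k$-dominates $\mathbf{q}$ if there is a set $S$ of $k$ coordinates such that $p_j\le q_j$ for all $j\in S$ and $p_j<q_j$ for at least one $j\in S$. The $k$-dominant skyline of a finite set is the set of its points not $k$-dominated by any other of its points. *)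

(* Defs.v *)
From HB Require Import structures.
From mathcomp Require Import all_boot all_order all_algebra finmap.
From mathcomp Require Import all_classical all_reals all_analysis.

Set Implicit Arguments.
Unset Strict Implicit.
Unset Printing Implicit Defensive.

Import Order.TTheory GRing.Theory Num.Theory.
Import numFieldNormedType.Exports.

Local Open Scope classical_set_scope.
Local Open Scope ring_scope.

(* [measurableTypeR R] is [R] with its Borel sets, in the form on which
   [lebesgue_measure] is declared as a measure; tuples over it carry the
   product sigma-algebra. *)
Notation rpoint R d := (d.-tuple (measurableTypeR R)).

Section lebesgue_measure_rpoint.
Context {R : realType}.
Local Open Scope ereal_scope.

Definition cons_rpoint n (z : measurableTypeR R * rpoint R n) : rpoint R n.+1 :=
  [tuple of z.1 :: z.2].

Lemma measurable_cons_rpoint n : measurable_fun setT (@cons_rpoint n).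
Proof. exact: measurable_cons. Qed.

Section step.
Variables (n : nat) (m : {sigma_finite_measure set (rpoint R n) -> \bar R}).

Definition lebesgue_rpoint_step : set (rpoint R n.+1) -> \bar R :=
  pushforward (@lebesgue_measure R \x m) (@cons_rpoint n).

Let step0 : lebesgue_rpoint_step set0 = 0.
Proof. by rewrite /lebesgue_rpoint_step /pushforward preimage_set0 measure0. Qed.

Let step_ge0 A : 0 <= lebesgue_rpoint_step A.
Proof. exact: (measure_ge0 (@lebesgue_measure R \x m)). Qed.

Let step_sigma_additive : semi_sigma_additive lebesgue_rpoint_step.
Proof.
move=> F mF tF mUF; rewrite /lebesgue_rpoint_step /pushforward preimage_bigcup.
apply: measure_semi_sigma_additive.
- by move=> k; rewrite -[X in measurable X]setTI; exact: measurable_cons_rpoint.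
- apply/trivIsetP => /= i j _ _ ij; rewrite -preimage_setI.
  by move/trivIsetP : tF => /(_ _ _ _ _ ij) ->//; rewrite preimage_set0.
- rewrite -preimage_bigcup -[X in measurable X]setTI.
  exact: measurable_cons_rpoint.
Qed.

HB.instance Definition _ := isMeasure.Build _ _ _ lebesgue_rpoint_step
  step0 step_ge0 step_sigma_additive.

Let step_sigma_finite : sigma_finite setT lebesgue_rpoint_step.
Proof.
have /sigma_finiteP[F [TF ndF Foo]] := sigma_finiteT (@lebesgue_measure R).
have /sigma_finiteP[G [TG ndG Goo]] := sigma_finiteT m.
pose uncons (t : rpoint R n.+1) : measurableTypeR R * rpoint R n :=
  (thead t, [tuple of behead t]).
have muncons : measurable_fun setT uncons.
  apply: measurable_fun_pair; first exact: measurable_tnth.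
  exact: measurable_behead.
have unconsK t : uncons (cons_rpoint t) = t.
  by case: t => x t; rewrite /uncons /cons_rpoint /=; congr pair; exact: val_inj.
exists (fun k => uncons @^-1` (F k `*` G k)).
  rewrite -preimage_bigcup (_ : \bigcup_k _ = setT)// -subTset => -[x t] _.
  have [i _ Fx] : (\bigcup_i F i) x by rewrite -TF.
  have [j _ Gt] : (\bigcup_i G i) t by rewrite -TG.
  exists (maxn i j) => //; split.
  - by move: x Fx; exact/subsetPset/ndF/leq_maxl.
  - by move: t Gt; exact/subsetPset/ndG/leq_maxr.
move=> k; have [mF Fk] := Foo k; have [mG Gk] := Goo k; split.
  by rewrite -[X in measurable X]setTI; apply: muncons => //; exact: measurableX.
rewrite /lebesgue_rpoint_step /pushforward -comp_preimage.
rewrite (_ : uncons \o _ = id); last by apply/funext => t; exact: unconsK.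
by rewrite preimage_id product_measure1E// lte_mul_pinfty// ge0_fin_numE.
Qed.

HB.instance Definition _ := Measure_isSigmaFinite.Build _ _ _
  lebesgue_rpoint_step step_sigma_finite.

End step.

Fixpoint lebesgue_rpoint (n : nat) :
    {sigma_finite_measure set (rpoint R n) -> \bar R} :=
  if n is n'.+1 then lebesgue_rpoint_step (lebesgue_rpoint n')
  else \d_([tuple] : rpoint R 0).

Lemma lebesgue_rpoint_box n (A : 'I_n -> set (measurableTypeR R)) :
  (forall j, measurable (A j)) ->
  lebesgue_rpoint n [set x | forall j, A j (tnth x j)] =
  \prod_(j < n) lebesgue_measure (A j).
Proof.
elim: n A => [|n IHn] A mA.
  rewrite big_ord0/= diracE mem_set//= => j; by case: j.
rewrite big_ord_recl -(IHn (fun j => A (lift ord0 j)))//=.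
rewrite /lebesgue_rpoint_step /pushforward.
rewrite -product_measure1E//=; last first.
  rewrite [X in measurable X](_ : _ = \bigcap_(j : 'I_n)
    ((fun x : rpoint R n => tnth x j) @^-1` (A (lift ord0 j)))); last first.
    by apply/seteqP; split => x H j; [move=> _|]; exact: H.
  apply: fin_bigcap_measurable => // j _.
  by rewrite -[X in measurable X]setTI; exact: measurable_tnth.
congr (_ _); apply/seteqP; split => -[x t] /=.
  move=> H; split; first by have := H ord0.
  by move=> j; have := H (lift ord0 j); rewrite /cons_rpoint tnthS.
move=> -[Ax At] j; case: (unliftP ord0 j) => [i ->|->//].
by rewrite /cons_rpoint tnthS.
Qed.

End lebesgue_measure_rpoint.

Section kskyline.
Context {R : realType} {d : nat}.
Local Open Scope fset_scope.

Definition kdominates (k : nat) (p q : rpoint R d) : bool :=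
  [exists S : {set 'I_d}, [&& #|S| == k,
    [forall j in S, (tnth p j <= tnth q j :> R)%R] &
    [exists j in S, (tnth p j < tnth q j :> R)%R]]].

Definition kskyline (k : nat) (A : {fset rpoint R d}) : {fset rpoint R d} :=
  [fset q in A | ~~ [exists p : A, (val p != q) && kdominates k (val p) q]].

End kskyline.

Definition neg_simplex (R : realType) (d : nat) : set (rpoint R d) :=
  [set x | (forall j, -1 <= (tnth x j : R) <= 0) /\
           \sum_(j < d) `|tnth x j : R| <= 1].
Arguments neg_simplex R d : clear implicits.

Definition uniform_on (R : realType) (d : nat) (S : set (rpoint R d))
    (disp : measure_display) (T : measurableType disp) (P : probability T R)
    (X : {RV P >-> rpoint R d}) : Prop :=
  forall B : set (rpoint R d), measurable B ->
    (distribution P X B = lebesgue_rpoint d (B `&` S) / lebesgue_rpoint d S)%E.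

Definition mutually_independent (R : realType) (disp disp' : measure_display)
    (T : measurableType disp) (P : probability T R) (E : measurableType disp')
    (I : finType) (X : I -> {RV P >-> E}) : Prop :=
  forall (J : {set I}) (B : I -> set E),
    (forall i, i \in J -> measurable (B i)) ->
    (P (\bigcap_(i in [set` J]) (X i @^-1` B i)) =
     \prod_(i in J) P (X i @^-1` B i))%E.

(* The points of the sample are collected into a finite set, so coinciding
   points are counted once. *)
Definition num_kskyline (R : realType) (d k n : nat)
    (disp : measure_display) (T : measurableType disp) (P : probability T R)
    (X : 'I_n -> {RV P >-> rpoint R d}) (w : T) : R :=
  #|` kskyline k [fset X i w | i : 'I_n]%fset|%:R.

(* Main.v *)
(** Cut [-1, 0]^d into cells of side 1/N.  Each of the finitely many cells inside
    the simplex has the same positive probability, so by independence all of them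
    contain a sample point except on an event whose probability decays
    geometrically in n.

    If k < d and N = 2 d^2, every point of the simplex lies strictly above some cell
    in all coordinates but the one of largest absolute value; once all cells are
    hit, the k-dominant skyline is therefore empty, and it never has more than n
    points.

    If k = d, for every L there are L pairwise disjoint subsets of the simplex, each
    closed under domination and containing a cell of the grid with N = d L.  Once
    all cells are hit, each of these subsets contains a skyline point. *)

Require Import Defs.
From mathcomp Require Import all_boot all_order all_algebra finmap.
From mathcomp Require Import all_classical all_reals all_analysis.
From mathcomp Require Import measurable_realfun zify ring lra.

Import Order.TTheory GRing.Theory Num.Theory.
Import numFieldNormedType.Exports.

Local Open Scope classical_set_scope.
Local Open Scope ring_scope.

(** * Bounds on expectations, and a union bound *)

Section expectation_bounds.
Context {R : realType} (disp : measure_display) (T : measurableType disp).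
Variable P : probability T R.
Implicit Types X Y : T -> R.
Local Open Scope ereal_scope.

(** The integral of a nonnegative function is a supremum over the simple functions below it, hence
    monotone for arbitrary functions. Skyline counts can thus be bounded without first proving them
    measurable. *)
Lemma ge0_expectation_le X Y :
  (forall w, 0 <= X w)%R -> (forall w, X w <= Y w)%R -> 'E_P[X] <= 'E_P[Y].
Proof.
move=> X0 XY; rewrite unlock !ge0_integralTE; last 2 first.
- by move=> w; rewrite lee_fin (le_trans (X0 w)).
- by move=> w; rewrite lee_fin.
apply: ereal_sup_le => _ [h hX <-]; exists h => // w.
by apply: le_trans (hX w) _; rewrite lee_fin.
Qed.

Lemma expectation_cst_indic (c : R) (A : set T) : (0 <= c)%R ->
  measurable A -> 'E_P[fun w => (c * \1_A w)%R] = c%:E * P A.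
Proof.
move=> c0 mA; rewrite unlock.
under eq_integral do rewrite EFinM.
rewrite ge0_integralZl_EFin//=; last first.
  by apply/measurable_EFinP; exact: measurable_indic.
by rewrite integral_indic// setIT.
Qed.

Lemma expectation_le_supported (X : T -> R) (c : R) (B : set T) :
  measurable B -> (forall w, 0 <= X w <= c)%R ->
  (forall w, ~ B w -> X w = 0%R) -> 'E_P[X] <= c%:E * P B.
Proof.
move=> mB Xc XB.
have c0 : (0 <= c)%R by have /andP[/le_trans] := Xc point; apply.
rewrite -expectation_cst_indic//; apply: ge0_expectation_le => w.
  by have /andP[] := Xc w.
rewrite indicE; have [/set_mem Bw|/negP Bw] := boolP (w \in B).
  by rewrite mulr1; have /andP[] := Xc w.
by rewrite mulr0 XB// => /mem_set.
Qed.

Lemma expectation_ge_outside (X : T -> R) (c : R) (B : set T) :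
  measurable B -> (0 <= c)%R -> (forall w, 0 <= X w)%R ->
  (forall w, ~ B w -> c <= X w)%R -> c%:E * P (~` B) <= 'E_P[X].
Proof.
move=> mB c0 X0 XB; rewrite -expectation_cst_indic//; last exact: measurableC.
apply: ge0_expectation_le => w; first by rewrite mulr_ge0.
rewrite indicE; have [/set_mem Bw|] := boolP (w \in ~` B).
  by rewrite mulr1 XB.
by rewrite mulr0.
Qed.

Lemma probability_bigsetU_le (I : finType) (A : I -> set T) (c : R) :
  (forall i, measurable (A i)) -> (forall i, P (A i) <= c%:E) ->
  P (\big[setU/set0]_(i : I) A i) <= (#|I|%:R * c)%:E.
Proof.
move=> mA Ac; rewrite (_ : (_ * c)%:E = \sum_(i : I) c%:E); last first.
  by rewrite sumEFin big_const iter_addr_0 mulr_natl cardE.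
suff [] : measurable (\big[setU/set0]_(i : I) A i) /\
   P (\big[setU/set0]_(i : I) A i) <= \sum_(i : I) c%:E by [].
elim/big_rec2 : _ => [|i y B _ [mB By]]; first by rewrite measure0.
split; first exact: measurableU.
by apply: le_trans; [exact: measureU2|exact: leeD (Ac i) By].
Qed.

End expectation_bounds.

(** * Probability that independent samples miss some set of a finite family *)

Section hitting.
Context {R : realType} (disp disp' : measure_display).
Variables (T : measurableType disp) (P : probability T R).
Variable E : measurableType disp'.

(** Almost surely all samples lie in [S], and by independence they all miss a given [C f] with
    probability [(1 - c) ^+ n]; a union bound over [I] concludes. *)
Lemma missed_sets_probability (I : finType) (C : I -> set E) (S : set E)
    (n : nat) (X : 'I_n -> {RV P >-> E}) (c : R) :
  mutually_independent X -> measurable S -> (forall f, measurable (C f)) ->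
  (forall i, P (X i @^-1` S) = 1%E) ->
  (forall i f, P (X i @^-1` C f) = c%:E) ->
  exists B : set T, [/\ measurable B,
    (P B <= (#|I|%:R * (1 - c) ^+ n)%:E)%E &
    forall w, ~ B w -> (forall i, S (X i w)) /\
                       (forall f, exists i, C f (X i w))].
Proof.
move=> indepX mS mC PS PC.
have mX i D : measurable D -> measurable (X i @^-1` D).
  by move=> mD; rewrite -[X in measurable X]setTI; exact: measurable_funPT.
pose N := \big[setU/set0]_(i < n) (X i @^-1` (~` S)).
pose A f := \bigcap_(i in [set` [set: 'I_n]%SET]) (X i @^-1` (~` C f)).
have mN : measurable N by apply: bigsetU_measurable => i _; exact/mX/measurableC.
have mA f : measurable (A f).
  by apply: fin_bigcap_measurable => // i _; exact/mX/measurableC.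
have mU : measurable (\big[setU/set0]_f A f) by exact: bigsetU_measurable.
exists (N `|` \big[setU/set0]_f A f); split.
- exact: measurableU.
- apply: le_trans; first exact: measureU2.
  rewrite -[leRHS]add0e leeD//.
    (* The union bound with constant 0 shows that [N] is a null event. *)
    rewrite (_ : 0%E = (#|'I_n|%:R * 0)%:E); last by rewrite mulr0.
    apply: probability_bigsetU_le => i; first exact/mX/measurableC.
    by rewrite preimage_setC probability_setC ?PS ?subee//; exact: mX.
  apply: probability_bigsetU_le => // f.
  rewrite /A indepX => [|i _]; last exact/measurableC.
  rewrite (eq_bigr (fun=> (1 - c)%:E)) => [|i _]; last first.
    by rewrite preimage_setC probability_setC ?PC//; exact: mX.
  by rewrite prodEFin prodr_const cardsT card_ord.
- move=> w Bw; split=> [i|f]; apply: contrapT => H; apply: Bw; [left|right].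
    by rewrite /N -bigcup_seq; exists i => //=; rewrite mem_index_enum.
  rewrite -bigcup_seq; exists f => /=; first by rewrite mem_index_enum.
  by move=> i _ CfX; apply: H; exists i.
Qed.

End hitting.

(* With [s = sqrt q], Bernoulli's inequality gives [n s^n <= 1 / (1 - s)]. *)
Lemma cvg_natM_geometric (R : realType) (q : R) : 0 <= q < 1 ->
  n%:R * q ^+ n @[n --> \oo] --> (0 : R).
Proof.
move=> /andP[q0 q1]; pose s := Num.sqrt q.
have s0 : 0 <= s by exact: sqrtr_ge0.
have s1 : s < 1 by rewrite -sqrtr1 ltr_sqrt.
have sq : s ^+ 2 = q by rewrite sqr_sqrtr.
have h0 : 0 < 1 - s by rewrite subr_gt0.
have bern n : (n%:R * s ^+ n) * (1 - s) <= 1.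
  suff : (1 + n%:R * (1 - s)) * s ^+ n <= 1.
    by apply: le_trans; rewrite mulrDl mul1r mulrAC lerDr exprn_ge0.
  elim: n => [|n IHn]; first by rewrite mul0r addr0 mulr1.
  apply: le_trans IHn; rewrite exprS mulrA ler_wpM2r ?exprn_ge0//.
  rewrite -subr_ge0 (_ : _ - _ = n.+1%:R * (1 - s) ^+ 2).
    by rewrite mulr_ge0 ?sqr_ge0.
  by rewrite -natr1; ring.
(* Split [q^n] as [s^n s^n]: one factor absorbs [n], the other tends to 0. *)
apply: (@squeeze_cvgr _ _ _ _ (fun=> 0) (fun n => (1 - s)^-1 * s ^+ n)).
- apply: nearW => n; rewrite mulr_ge0 ?exprn_ge0//=.
  rewrite -sq exprAC expr2 mulrA ler_wpM2r ?exprn_ge0//.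
  by rewrite -[leRHS]mul1r ler_pdivlMr.
- exact: cvg_cst.
- rewrite -(mulr0 (1 - s)^-1); apply: cvgMr; apply: cvg_expr.
  by rewrite ger0_norm.
Qed.

(** * Cells of the grid of side [1/N] and their position relative to the simplex *)

Definition grid_cell (R : realType) (d N : nat) (f : 'I_d -> nat) :
    set (rpoint R d) :=
  [set x | forall j, `](- ((f j).+1%:R / N%:R)), (- ((f j)%:R / N%:R))[%classic
                       (tnth x j : R)].
Arguments grid_cell R {d} N f.

Section grid.
Context {R : realType} {d : nat}.
Implicit Types (x y : rpoint R d) (N : nat).

Lemma measurable_grid_cell N (f : 'I_d -> nat) : measurable (grid_cell R N f).
Proof.
rewrite [X in measurable X](_ : _ = \bigcap_(j : 'I_d)
  ((fun x : rpoint R d => tnth x j) @^-1`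
   `](- ((f j).+1%:R / N%:R)), (- ((f j)%:R / N%:R))[%classic)); last first.
  by apply/seteqP; split => x H j; [move=> _|]; exact: H.
apply: fin_bigcap_measurable => // j _.
rewrite -[X in measurable X]setTI; apply: measurable_tnth => //.
Qed.

Lemma measurable_neg_simplex : measurable (neg_simplex R d).
Proof.
have mt (j : 'I_d) : measurable_fun setT (fun x : rpoint R d => tnth x j : R).
  exact: measurable_tnth.
rewrite [X in measurable X](_ : _ = (\bigcap_(j : 'I_d)
  ((fun x : rpoint R d => tnth x j : R) @^-1` `[-1, 0]%classic)) `&`
  ((fun x : rpoint R d => \sum_(j < d) `|tnth x j : R|) @^-1`
    `]-oo, 1]%classic)); last first.
  apply/seteqP; split => x [H1 H2]; split.
  - by move=> j _; rewrite /= in_itv/= H1.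
  - by rewrite /= in_itv.
  - by move=> j; have := H1 j Logic.I; rewrite /= in_itv.
  - by move: H2; rewrite /= in_itv.
apply: measurableI.
  apply: fin_bigcap_measurable => // j _.
  by rewrite -[X in measurable X]setTI; apply: mt.
rewrite -[X in measurable X]setTI; apply: measurable_sum => // j.
by apply: measurableT_comp => //; exact: mt.
Qed.

Lemma lebesgue_grid_cell N (f : 'I_d -> nat) : (0 < N)%N ->
  lebesgue_rpoint d (grid_cell R N f) = (N%:R^-1 ^+ d)%:E.
Proof.
move=> N0; rewrite /grid_cell.
rewrite (lebesgue_rpoint_box (A := fun j => `](- ((f j).+1%:R / N%:R)),
   (- ((f j)%:R / N%:R))[%classic)); last by move=> j; exact: measurable_itv.
rewrite (eq_bigr (fun=> (N%:R^-1)%:E)) => [|j _].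
  by rewrite prodEFin prodr_const card_ord.
rewrite lebesgue_measure_itv/= lte_fin ifT.
  by rewrite -EFinB -natr1; congr EFin; ring.
by rewrite ltrN2 ltr_pM2r ?invr_gt0 ?ltr0n// ltr_nat.
Qed.

Lemma neg_simplex_norm x j : neg_simplex R d x ->
  `|tnth x j : R| = - (tnth x j : R).
Proof. by move=> [/(_ j)/andP[_ x0] _]; rewrite ler0_norm. Qed.

(** Indices count steps away from the origin, so the bound on [f] says that the corner of the cell
    farthest from the origin has coordinates of absolute sum at most 1. *)
Lemma grid_cell_sub_simplex N (f : 'I_d -> nat) : (0 < N)%N ->
  (\sum_(j < d) (f j).+1 <= N)%N -> grid_cell R N f `<=` neg_simplex R d.
Proof.
move=> N0 fN x xf.
have Np : 0 < N%:R :> R by rewrite ltr0n.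
have x0 j : (tnth x j : R) <= 0.
  have := xf j; rewrite /= in_itv/= => /andP[_ /ltW/le_trans]; apply.
  by rewrite oppr_le0 divr_ge0.
have xN j : `|tnth x j : R| <= (f j).+1%:R / N%:R.
  have := xf j; rewrite /= in_itv/= => /andP[/ltW + _].
  by rewrite ler0_norm// lerNl.
have S1 : \sum_(j < d) `|tnth x j : R| <= 1.
  apply: (le_trans (ler_sum _ (fun j _ => xN j))).
  by rewrite -mulr_suml -natr_sum ler_pdivrMr// mul1r ler_nat.
split=> // j; rewrite x0 andbT.
have : `|tnth x j : R| <= 1.
  by apply: le_trans S1; rewrite (bigD1 j)//= lerDl sumr_ge0.
by rewrite ler_norml => /andP[].
Qed.

(* The exempted coordinate [i] has the largest absolute value, so that the others
   sum to at most [1 - 1 / d]; this leaves room for rounding them up to the grid. *)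
Lemma exists_grid_cell_below x N : (0 < d)%N -> (2 * d ^ 2 <= N)%N ->
  neg_simplex R d x ->
  exists (i : 'I_d) (f : 'I_d -> nat), (\sum_(j < d) (f j).+1 <= N)%N /\
    forall y, grid_cell R N f y ->
      forall j, j != i -> (tnth y j : R) < tnth x j.
Proof.
move=> d0 dN Sx.
have N0 : (0 < N)%N by apply: leq_trans dN; rewrite muln_gt0 expn_gt0 d0.
have Np : 0 < N%:R :> R by rewrite ltr0n.
have dp : 0 < d%:R :> R by rewrite ltr0n.
pose u j : R := `|tnth x j : R|.
case: (arg_maxP (fun j : 'I_d => u j) (i0 := Ordinal d0) (P := predT)) => // i _ ui.
(* As [u i] is at least the average, [s <= (1 - 1/d) (u i + s) <= 1 - 1/d], here multiplied by
   [d]. *)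
have su : d%:R * (\sum_(j < d | j != i) u j) <= d%:R - 1.
  set s := \sum_(_ < _ | _) _.
  have us : \sum_(j < d) u j = u i + s by rewrite (bigD1 i).
  have S2 : u i + s <= d%:R * u i.
    rewrite -us mulr_natl -[X in _ *+ X]card_ord -sumr_const.
    by apply: ler_sum => j _; exact: ui.
  have S1 : u i + s <= 1 by rewrite -us; have [] := Sx.
  have : (d%:R - 1) * (u i + s) <= d%:R - 1.
    by rewrite ler_piMr// subr_ge0 ler1n.
  by nra.
(* Rounding [N * u j] strictly up puts the whole cell strictly below [x] at [j]; the exempted [i]
   gets the cheapest index, 0. *)
pose f' j := if j == i then 0%N else (Num.truncn (N%:R * u j)).+1.
exists i, f'; split.
  rewrite -(ler_nat R) natr_sum (bigD1 i)//= {1}/f' eqxx.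
  have : \sum_(j < d | j != i) (f' j).+1%:R <=
         \sum_(j < d | j != i) (N%:R * u j + 2) :> R.
    apply: ler_sum => j ji; rewrite /f' (negbTE ji).
    have /andP[+ _] := @truncn_itv R (N%:R * u j) (mulr_ge0 (ltW Np) (normr_ge0 _)).
    by rewrite -[X in _ -> X%:R <= _]addn2 natrD lerD2r.
  move/(lerD (lexx 1))/le_trans; apply.
  rewrite big_split/= -mulr_sumr sumr_const.
  have -> : #|[pred j : 'I_d | j != i]| = d.-1.
    by have := cardC1 i; rewrite card_ord.
  have dN' : 2 * d%:R ^+ 2 <= N%:R :> R by rewrite -natrX -natrM ler_nat.
  have -> : 2 *+ d.-1 = 2 * (d%:R - 1) :> R.
    by rewrite -mulr_natr -subn1 natrB.
  set s := \sum_(_ < _ | _) _ in su *.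
  (* Multiplied by [d], and by the bound on [d * s], the goal reduces to [d + 2 d (d - 1) <= N],
     which follows from [2 d^2 <= N]. *)
  rewrite -(ler_pM2l dp).
  have : N%:R * (d%:R * s) <= N%:R * (d%:R - 1) :> R by rewrite ler_pM2l.
  nra.
move=> y yf j ji; have := yf j; rewrite /= in_itv/= /f' (negbTE ji) => /andP[_].
move/lt_trans; apply; rewrite ltrNl -neg_simplex_norm// ltr_pdivlMr// mulrC.
exact: truncnS_gt.
Qed.

End grid.

(** * Domination and skylines of finite sets *)

Section skyline.
Context {R : realType} {d : nat}.
Implicit Types (p q : rpoint R d) (A : {fset rpoint R d}).

(** Any [k] of the [d - 1] coordinates other than [i] serve as the witness set; [1 <= k] makes it
    nonempty, which yields the strict inequality. *)
Lemma kdominates_lt_but_one k (i : 'I_d) p q : (1 <= k <= d - 1)%N ->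
  (forall j, j != i -> (tnth p j : R) < tnth q j) -> kdominates k p q.
Proof.
move=> /andP[k1 kd] pq; pose s := take k (enum [set~ i]%SET).
have ss : size s = k.
  rewrite size_takel// -cardE; have := cardsC1 i.
  by rewrite card_ord => ->; rewrite -subn1.
have s_lt j : j \in s -> (tnth p j : R) < tnth q j.
  by move=> /mem_take; rewrite mem_enum !inE => /pq.
apply/existsP; exists [set j in s]%SET; apply/and3P; split.
- by rewrite cardsE; apply/eqP; rewrite -[RHS]ss; apply/card_uniqP/take_uniq/enum_uniq.
- by apply/forall_inP => j; rewrite inE => /s_lt/ltW.
- have : (0 < size s)%N by rewrite ss.
  case: s s_lt {ss} => // j s s_lt _; apply/exists_inP; exists j.
    by rewrite inE mem_head.
  by apply: s_lt; rewrite mem_head.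
Qed.

Lemma kskyline_eq0 k A : (forall q, q \in A ->
    exists2 p, p \in A & (p != q) && kdominates k p q) ->
  kskyline k A = fset0.
Proof.
move=> dom; apply/fsetP => q; rewrite !inE /=; apply/negbTE/negP => /andP[qA].
case/negP; have [p pA pq] := dom q qA.
by apply/existsP; exists [` pA]%fset.
Qed.

Lemma card_kskyline_le k n (x : 'I_n -> rpoint R d) :
  (#|` kskyline k [fset x i | i : 'I_n]%fset| <= n)%N.
Proof.
rewrite (leq_trans (n := #|` [fset x i | i : 'I_n]%fset|))//.
  by apply: fsubset_leq_card; apply/fsubsetP => q; rewrite !inE => /andP[].
by rewrite (leq_trans (leq_imfset_card _ _ _))//= -[leqRHS]card_ord cardE.
Qed.

(** A set of [d] coordinates contains all of them, so [d]-dominance is ordinary Pareto dominance. *)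
Lemma kdominates_full p q : kdominates d p q ->
  (forall j, (tnth p j : R) <= tnth q j) /\ exists j, (tnth p j : R) < tnth q j.
Proof.
move=> /existsP[S /and3P[/eqP Sd /forall_inP le_pq /exists_inP[j _ lt_pq]]].
have ST : S = [set: 'I_d]%SET.
  by apply/eqP; rewrite eqEcard finset.subsetT cardsT card_ord Sd /=.
by split=> [l|]; [apply: le_pq; rewrite ST inE | exists j].
Qed.

(* A sample point of [D] with least coordinate sum is not dominated. *)
Lemma kskyline_meets_downset A (D : set (rpoint R d)) :
  (exists2 q, q \in A & D q) ->
  (forall p q, p \in A -> D q -> (forall j, (tnth p j : R) <= tnth q j) -> D p) ->
  exists2 q, q \in kskyline d A & D q.
Proof.
move=> [q0 q0A Dq0] downD.
pose F (z : A) : R := \sum_(j < d) (tnth (val z) j : R).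
have Pq0 : `[< D (val [` q0A]%fset) >] by apply/asboolP.
case: (arg_minP (i0 := [` q0A]%fset) F (P := fun z => `[< D (val z) >]) Pq0).
move=> q /asboolP Dq q_min; exists (val q) => //.
rewrite !inE /= (valP q) /=; apply/negP => /existsP[p /andP[_]].
move=> /kdominates_full[le_pq [j lt_pq]].
(* A dominating [p] would again lie in [D], with a strictly smaller coordinate sum. *)
have /q_min : `[< D (val p) >] by apply/asboolP; apply: downD le_pq => //; exact: valP.
apply/negP; rewrite -ltNge /F (bigD1 j)//= [ltRHS](bigD1 j)//=.
by rewrite ltr_leD// ler_sum.
Qed.

Lemma leq_card_disjoint_hits L A (D : 'I_L -> set (rpoint R d)) :
  (forall a b q, D a q -> D b q -> a = b) ->
  (forall a, exists2 q, q \in A & D a q) -> (L <= #|` A|)%N.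
Proof.
move=> disjD hitD.
have /boolp.choice[g gP] : forall a, exists q, q \in A /\ D a q.
  by move=> a; have [q] := hitD a; exists q.
have g_inj : injective g.
  move=> a b gab; apply: disjD (proj2 (gP a)) _.
  by rewrite gab; exact: (proj2 (gP b)).
have gL : #|` [fset g a | a : 'I_L]%fset| = L.
  by rewrite card_imfset//= -[RHS]card_ord cardE.
rewrite -[leqLHS]gL; apply: fsubset_leq_card; apply/fsubsetP => q /imfsetP[a _ ->].
exact: (proj1 (gP a)).
Qed.

End skyline.

(** * Deterministic consequences of every cell being hit *)

Section simplex_samples.
Context {R : realType} {d : nat}.

Lemma kskyline_cells_hit_eq0 k N n (x : 'I_n -> rpoint R d) :
  (1 <= k <= d - 1)%N -> (2 * d ^ 2 <= N)%N ->
  (forall i, neg_simplex R d (x i)) ->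
  (forall f : 'I_d -> nat, (\sum_(j < d) (f j).+1 <= N)%N ->
    exists i, grid_cell R N f (x i)) ->
  kskyline k [fset x i | i : 'I_n]%fset = fset0.
Proof.
move=> kd dN Sx hit; apply: kskyline_eq0 => q /imfsetP[i _ ->].
have d_gt0 : (0 < d)%N by lia.
have [m [f [fN lt_f]]] := exists_grid_cell_below _ _ d_gt0 dN (Sx i).
have [i' xi'] := hit f fN; exists (x i'); first by apply/imfsetP; exists i'.
have lt_xx := lt_f _ xi'.
rewrite (kdominates_lt_but_one _ _ _ _ kd lt_xx) andbT.
(* The dominating point differs from the dominated one: it is strictly smaller at some coordinate
   other than [m], which exists because [1 <= k <= d - 1] forces [d >= 2]. *)
have /set0Pn[j] : [set~ m]%SET != finset.set0.
  by rewrite -card_gt0 cardsC1 card_ord; lia.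
rewrite !inE => /lt_xx; apply: contraTneq => ->.
by rewrite ltxx.
Qed.

Lemma card_kskyline_cells_hit (d_ge2 : (2 <= d)%N) L n (x : 'I_n -> rpoint R d) :
  (forall i, neg_simplex R d (x i)) ->
  (forall f : 'I_d -> nat, (\sum_(j < d) (f j).+1 <= d * L)%N ->
    exists i, grid_cell R (d * L) f (x i)) ->
  (L <= #|` kskyline d [fset x i | i : 'I_n]%fset|)%N.
Proof.
move=> Sx hit.
have d_gt0 : (0 < d)%N by apply: leq_trans d_ge2.
pose j0 : 'I_d := Ordinal d_gt0; pose j1 : 'I_d := Ordinal d_ge2.
have j10 : j1 != j0 by [].
(* The thresholds on the absolute values of the two coordinates, [a / L] and [(L - a - 1) / L], sum
   to [1 - 1/L]: this leaves room for a cell, yet is large enough for disjointness. *)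
pose D (a : 'I_L) := neg_simplex R d `&` [set y : rpoint R d |
  (tnth y j0 : R) < - (a%:R / L%:R) /\
  (tnth y j1 : R) < - ((L - a.+1)%:R / L%:R)].
apply: (leq_card_disjoint_hits _ _ D).
(* For [a < b], a common point would have absolute coordinate sum above
   [b / L + (L - a - 1) / L >= 1]. *)
- suff le_ba (a b : 'I_L) q : D a q -> D b q -> (b <= a)%N.
    by move=> a b q Da Db; apply/val_inj/anti_leq; rewrite !(le_ba _ _ q).
  move=> [Sq [_ a1]] [_ [b0 _]]; rewrite leqNgt; apply/negP => ab.
  have := Sq.2; apply/negP; rewrite -ltNge (bigD1 j0)//= (bigD1 j1)//= addrA.
  rewrite ltr_wpDr ?sumr_ge0// !neg_simplex_norm//.
  have Lp : 0 < L%:R :> R by rewrite ltr0n (leq_trans _ (ltn_ord a)).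
  apply: (@le_lt_trans _ _ (b%:R / L%:R + (L - a.+1)%:R / L%:R)).
    rewrite -mulrDl -natrD ler_pdivlMr// mul1r ler_nat.
    by have := ltn_ord a; lia.
  by rewrite ltrD// ltrNr.
- move=> a; have aL := ltn_ord a.
  have Lp : 0 < L%:R :> R by rewrite ltr0n; lia.
  have dp : 0 < d%:R :> R by rewrite ltr0n.
  (* [D a] is closed downwards only within the simplex, which suffices since all sample points lie
     there. *)
  apply: kskyline_meets_downset; last first.
    move=> p q /imfsetP[i _ ->] [Sq [q0 q1]] le_q; split; first exact: Sx.
    by split; apply: le_lt_trans (le_q _) _.
  (* On the grid of side [1 / (d L)] both thresholds are grid values; the indices sum to
     [d (L - 1)], and the [d] successors bring the total to exactly [d L]. *)
  pose f j := if j == j0 then (d * a)%N else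
              if j == j1 then (d * (L - a.+1))%N else 0%N.
  have fdL : (\sum_(j < d) (f j).+1 <= d * L)%N.
    rewrite (eq_bigr (fun j => f j + 1)%N) => [|j _]; last by rewrite addn1.
    rewrite big_split/= sum_nat_const card_ord muln1 (bigD1 j0)//= (bigD1 j1)//=.
    rewrite big1 => [|j /andP[/negbTE jj0 /negbTE jj1]]; last by rewrite /f jj0 jj1.
    rewrite /f eqxx (negbTE j10) eqxx addn0 -mulnDr -[X in (_ + X)%N]muln1 -mulnDr.
    by rewrite leq_mul2l; apply/orP; right; lia.
  have [i xi] := hit f fdL; exists (x i); first by apply/imfsetP; exists i.
  have scale m : (d * m)%:R / (d * L)%:R = m%:R / L%:R :> R.
    by rewrite !natrM -mulf_div divff ?mul1r// gt_eqF.
  split; first exact: Sx.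
  split; [have := xi j0 | have := xi j1].
    by rewrite /= in_itv/= /f eqxx scale => /andP[].
  by rewrite /= in_itv/= /f (negbTE j10) eqxx scale => /andP[].
Qed.


End simplex_samples.

(** * Uniform samples hit all cells with high probability *)

Section uniform_samples.
Context {R : realType} {d : nat}.

(** The simplex lies in a unit cube and contains the cell of index 0, since [d <= N]. Its volume is
    therefore finite and positive, and the ratio of cell to simplex volume is a probability. *)
Lemma lebesgue_neg_simplex N : (0 < d)%N -> (d <= N)%N -> exists2 v : R,
  N%:R^-1 ^+ d <= v & lebesgue_rpoint d (neg_simplex R d) = v%:E.
Proof.
move=> d_gt0 dN; have N0 : (0 < N)%N by apply: leq_trans dN.
have S1 : (lebesgue_rpoint d (neg_simplex R d) <= 1%:E)%E.
  have mI (j : 'I_d) : measurable (`[-1, 0]%classic : set (measurableTypeR R)).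
    exact: measurable_itv.
  have := lebesgue_rpoint_box mI.
  rewrite (eq_bigr (fun=> 1%:E)) => [|j _]; last first.
    by rewrite lebesgue_measure_itv/= lte_fin ltrN10 -EFinB sub0r opprK.
  rewrite prodEFin prodr_const expr1n => <-; apply: le_measure.
  - by rewrite inE; exact: measurable_neg_simplex.
  - rewrite inE [X in measurable X](_ : _ = \bigcap_(j : 'I_d)
      ((fun x : rpoint R d => tnth x j) @^-1` `[-1, 0]%classic)); last first.
      by apply/seteqP; split => x H j; [move=> _|]; exact: H.
    apply: fin_bigcap_measurable => // j _.
    by rewrite -[X in measurable X]setTI; apply: measurable_tnth.
  - by move=> x [xI _] j; rewrite /= in_itv/= xI.
have cS : ((N%:R^-1 ^+ d)%:E <= lebesgue_rpoint d (neg_simplex R d))%E.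
  rewrite -(lebesgue_grid_cell N (fun=> 0%N) N0); apply: le_measure.
  - by rewrite inE; exact: measurable_grid_cell.
  - by rewrite inE; exact: measurable_neg_simplex.
  - apply: grid_cell_sub_simplex => //.
    by rewrite sum_nat_const card_ord muln1.
move: S1 cS; case: (lebesgue_rpoint d _) => [v| |] //= _ cv.
by exists v.
Qed.

(** [K] counts the admissible cells and [q] is the probability that one sample misses a given cell.
    Both are chosen before the probability space, which in the theorem varies with [n]. *)
Lemma cells_hit_probability N : (0 < d)%N -> (d <= N)%N -> exists K q : R,
  [/\ 0 <= K, 0 <= q < 1 & forall (disp : measure_display)
    (T : measurableType disp) (P : probability T R) (n : nat)
    (X : 'I_n -> {RV P >-> rpoint R d}),
  mutually_independent X -> (forall i, uniform_on (neg_simplex R d) (X i)) ->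
  exists B : set T, [/\ measurable B, (P B <= (K * q ^+ n)%:E)%E &
    forall w, ~ B w -> (forall i, neg_simplex R d (X i w)) /\
      forall f : 'I_d -> nat, (\sum_(j < d) (f j).+1 <= N)%N ->
        exists i, grid_cell R N f (X i w)]].
Proof.
move=> d_gt0 dN; have N0 : (0 < N)%N by apply: leq_trans dN.
have Np : 0 < N%:R :> R by rewrite ltr0n.
have [v cv vE] := lebesgue_neg_simplex _ d_gt0 dN.
have c0 : 0 < N%:R^-1 ^+ d :> R by rewrite exprn_gt0// invr_gt0.
have v0 : 0 < v by exact: lt_le_trans cv.
(* Bounding the indices by [N] gives a finite type and loses no cell: the sum condition forces
   [f j < N]. *)
pose I := {f : {ffun 'I_d -> 'I_N} | (\sum_(j < d) (f j).+1 <= N)%N}.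
pose c := N%:R^-1 ^+ d / v.
have cp : 0 < c by exact: divr_gt0.
have c1 : c <= 1 by rewrite ler_pdivrMr// mul1r.
exists #|{: I}|%:R, (1 - c); split => //.
  by rewrite subr_ge0 c1/= ltrBlDr ltrDl.
move=> disp T P n X indepX unifX.
have mS := @measurable_neg_simplex R d.
have [| | |B [mB PB hitB]] := @missed_sets_probability R _ _ T P _ I
  (fun f => grid_cell R N (fun j => val f j)) (neg_simplex R d) n X c indepX mS.
- by move=> f; exact: measurable_grid_cell.
- move=> i; apply: etrans (unifX i _ mS) _; rewrite setIid vE.
  by rewrite inver gt_eqF// -EFinM divff// gt_eqF.
- move=> i f; apply: etrans (unifX i _ (measurable_grid_cell _ _)) _.
  rewrite setIidl; last exact: grid_cell_sub_simplex (valP f).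
  by rewrite lebesgue_grid_cell// vE inver gt_eqF.
exists B; split => // w /hitB[Sw hitw]; split => // f fN.
have fltN j : (f j < N)%N by apply: leq_trans fN; rewrite (bigD1 j)//= leq_addr.
pose g : {ffun 'I_d -> 'I_N} := [ffun j => Ordinal (fltN j)].
have gf : (fun j => g j : nat) = f by apply/funext => j; rewrite ffunE.
have gN : (\sum_(j < d) (g j).+1 <= N)%N.
  by under eq_bigr do rewrite ffunE.
by have [i] := hitw (exist _ g gN); rewrite /= gf => Xi; exists i.
Qed.

End uniform_samples.

(** * The two limits of the expected skyline size *)

Theorem theorem3 (R : realType) (d : nat) (d_ge2 : (2 <= d)%N)
    (disp : nat -> measure_display)
    (T : forall n : nat, measurableType (disp n))
    (P : forall n : nat, probability (T n) R)
    (p : forall n : nat, 'I_n -> {RV (P n) >-> rpoint R d})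
    (p_indep : forall n : nat, mutually_independent (p n))
    (p_unif : forall (n : nat) (i : 'I_n), uniform_on (neg_simplex R d) (p n i))
    (k : nat) (k_bounds : (1 <= k <= d)%N) :
  ((k <= d - 1)%N ->
     ('E_(P n)[num_kskyline k (p n)])%E @[n --> \oo] --> (0%E : \bar R)) /\
  (k = d ->
     ('E_(P n)[num_kskyline k (p n)])%E @[n --> \oo] --> (+oo%E : \bar R)).
Proof.
have d_gt0 : (0 < d)%N by apply: leq_trans d_ge2.
split=> [kd|->].
- have k_lt : (1 <= k <= d - 1)%N by case/andP: k_bounds => -> _.
  have dN : (d <= 2 * d ^ 2)%N by nia.
  have [K [q [K0 q01 hit]]] := @cells_hit_probability R d _ d_gt0 dN.
  (* Off [B] the skyline is empty, and on [B] it has at most [n] points, so the expectation is at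
     most [n P(B) <= K n q^n]. *)
  apply: (@squeeze_cvge _ _ _ _ (fun=> 0%E) _ (fun n => (K * (n%:R * q ^+ n))%:E)).
  + apply: nearW => n.
    have [B [mB PB hitB]] := hit _ _ _ _ _ (p_indep n) (p_unif n).
    apply/andP; split.
      by rewrite unlock; apply: integral_ge0 => w _; rewrite lee_fin.
    apply: (@le_trans _ _ (n%:R%:E * P n B)%E).
      apply: expectation_le_supported => // [w|w /hitB[Sw hitw]].
        by rewrite ler0n ler_nat card_kskyline_le.
      by rewrite /num_kskyline (kskyline_cells_hit_eq0 _ _ _ _ k_lt (leqnn _) Sw hitw)
        cardfs0.
    by rewrite mulrCA EFinM lee_pmul// lee_fin.
  + exact: cvg_cst.
  + apply: cvg_EFin; first exact: nearW.
    rewrite -(mulr0 K); apply: cvgMr; exact: cvg_natM_geometric.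
- apply/cvgeyPge => A.
  pose L := (Num.truncn (2 * A)).+1.
  have AL : 2 * A <= L%:R by exact/ltW/truncnS_gt.
  have dN : (d <= d * L)%N by rewrite leq_pmulr.
  have [K [q [K0 /andP[q0 q1] hit]]] := @cells_hit_probability R d _ d_gt0 dN.
  have : K * q ^+ n @[n --> \oo] --> (0 : R).
    rewrite -(mulr0 K); apply: cvgMr; apply: cvg_expr.
    by rewrite ger0_norm.
  move=> /cvgr_lt /(_ (2^-1)) -/(_ ltac:(by rewrite invr_gt0)).
  apply: filterS => n Kq.
  have [B [mB PB hitB]] := hit _ _ _ _ _ (p_indep n) (p_unif n).
  apply: (@le_trans _ _ (L%:R%:E * P n (~` B))%E).
    apply: (@le_trans _ _ (L%:R * 2^-1)%:E).
      by rewrite lee_fin ler_pdivlMr// mulrC.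
    rewrite EFinM lee_pmul2l// ?lte_fin ?ltr0n// probability_setC//.
    rewrite leeBrDr; last by rewrite fin_num_measure.
    rewrite (_ : 1%E = (2^-1 + 2^-1)%:E); last by congr EFin; lra.
    by rewrite EFinD leeD2l// (le_trans PB)// lee_fin ltW.
  apply: expectation_ge_outside => // w /hitB[Sw hitw].
  by rewrite ler_nat card_kskyline_cells_hit.
Qed.
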